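(* For every integer $N\ge 1$, there exists a constant $C=C(N)$ such that for every $1\le p<\infty$, $$\left[\frac{u(x)-u(y)}{|x-y|^{\frac{N+1}{p}}}\right]_{M^p(\mathbb{R}^N\times\mathbb{R}^N)}\le C\,\|u\|_{L^\infty(\mathbb{R}^N)}^{1-1/p}\,\|\nabla u\|_{L^1(\mathbb{R}^N)}^{1/p}\qquad\text{for all }u\in C_c^\infty(\mathbb{R}^N).$$
   Context: $C_c^\infty(\mathbb{R}^N)$ is the space of real-valued smooth compactly supported functions on $\mathbb{R}^N$. For $1\le p<\infty$ and a measurable function $f$ on $\mathbb{R}^N\times\mathbb{R}^N$, the Marcinkiewicz (weak $L^p$) quasi-norm is defined by $$[f]_{M^p(\mathbb{R}^N\times\mathbb{R}^N)}^p=\sup_{\lambda>0}\lambda^p\,\mathcal{L}^{2N}\bigl(\{(x,y)\in\mathbb{R}^N\times\mathbb{R}^N:\ |f(x,y)|\ge\lambda\}\bigr),$$ where $\mathcal{L}^{2N}$ is Lebesgue measure on $\mathbb{R}^N\times\mathbb{R}^N$. The quotient is regarded as a function of $(x,y)$, defined for $x\ne y$. The constant $C$ depends only on $N$ (not on $p$ or $u$). For $p=1$ the factor $\|u\|_{L^\infty}^{0}$ is $1$. *)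

(* Defs.v *)
From HB Require Import structures.
From mathcomp Require Import all_boot all_order all_algebra.
From mathcomp Require Import all_classical all_reals all_analysis.

Set Implicit Arguments.
Unset Strict Implicit.
Unset Printing Implicit Defensive.
Import Order.TTheory GRing.Theory Num.Theory.
Import numFieldNormedType.Exports.
Local Open Scope classical_set_scope.
Local Open Scope ring_scope.

Definition measure_rV_display : measure_display -> measure_display.
Proof. exact. Qed.

(* Sigma-algebra on row vectors generated by the coordinates, as the library
   does for [n.-tuple T]; for [T := R] these are the Borel sets of R^n. *)
Section measurable_rV.
Context {d} {T : measurableType d}.
Variable n : nat.

Let coord (i : 'I_n) (x : 'rV[T]_n) : T := x ord0 i.

Let rV_set0 : g_sigma_preimage coord set0.
Proof. exact: sigma_algebra0. Qed.

Let rV_setC A : g_sigma_preimage coord A -> g_sigma_preimage coord (~` A).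
Proof. exact: sigma_algebraC. Qed.

Let rV_bigcup (F : (set 'rV[T]_n)^nat) :
  (forall i, g_sigma_preimage coord (F i)) ->
  g_sigma_preimage coord (\bigcup_i (F i)).
Proof. exact: sigma_algebra_bigcup. Qed.

HB.instance Definition _ := @isMeasurable.Build (measure_rV_display d)
  'rV[T]_n (g_sigma_preimage coord) rV_set0 rV_setC rV_bigcup.

End measurable_rV.

Section measurable_rV_theory.
Context {d} {T : measurableType d}.

Lemma measurable_rV_coord n (i : 'I_n) :
  measurable_fun [set: 'rV[T]_n] (fun x => x ord0 i).
Proof.
move=> _ Y mY; rewrite setTI; apply: sub_sigma_algebra => /=.
rewrite -bigcup_seq/=; exists i => /=; first by rewrite mem_index_enum.
by exists Y => //; rewrite setTI.
Qed.

Lemma measurable_fun_rV d' (S : measurableType d') n (f : S -> 'rV[T]_n) :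
  (forall i, measurable_fun [set: S] (fun x => f x ord0 i)) ->
  measurable_fun [set: S] f.
Proof.
move=> mf _ Y mY; rewrite setTI.
suff : g_sigma_preimage (fun i => (fun x : 'rV[T]_n => x ord0 i) \o f)
    `<=` measurable.
  by rewrite g_sigma_preimage_comp; apply; exists Y => //; rewrite setTI.
apply: smallest_sub; first exact: sigma_algebra_measurable.
case: n => [|n] in f mf Y mY *; first by rewrite big_ord0.
rewrite -bigcup_mkord_ord; apply: bigcup_sub => i Ii.
by move=> A [B mB <-]; exact: mf.
Qed.

Lemma measurable_rV_box n (A : 'I_n -> set T) :
  (forall i, measurable (A i)) ->
  measurable [set x : 'rV[T]_n | forall i, A i (x ord0 i)].
Proof.
move=> mA; rewrite (_ : [set _ | _] =
    \bigcap_(i in [set: 'I_n]) ((fun x : 'rV[T]_n => x ord0 i) @^-1` A i)).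
  apply: fin_bigcap_measurable => // i _.
  by rewrite -[X in measurable X]setTI; exact: measurable_rV_coord.
by apply/seteqP; split => [x Ax i _|x Ax i]; exact: Ax.
Qed.

End measurable_rV_theory.

Section lebesgue_measure_rV.
Context {R : realType}.

Definition rV_cons n (p : measurableTypeR R * 'rV[R]_n) : 'rV[R]_n.+1 :=
  row_mx (const_mx p.1 : 'rV[R]_1) p.2.

Definition rV_uncons n (x : 'rV[R]_n.+1) : measurableTypeR R * 'rV[R]_n :=
  (x ord0 ord0, \row_i x ord0 (lift ord0 i)).

Lemma rV_cons0 n p : @rV_cons n p ord0 ord0 = p.1.
Proof.
have -> : (ord0 : 'I_n.+1) = lshift n (ord0 : 'I_1) by exact/val_inj.
by rewrite [LHS]row_mxEl mxE.
Qed.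

Lemma rV_consS n p i : @rV_cons n p ord0 (lift ord0 i) = p.2 ord0 i.
Proof.
have -> : lift ord0 i = rshift 1 i by exact/val_inj.
by rewrite [LHS]row_mxEr.
Qed.

Lemma rV_consK n : cancel (@rV_cons n) (@rV_uncons n).
Proof.
move=> -[a x]; rewrite /rV_uncons rV_cons0; congr pair.
by apply/rowP => i; rewrite mxE rV_consS.
Qed.

Lemma rV_unconsK n : cancel (@rV_uncons n) (@rV_cons n).
Proof.
move=> x; apply/rowP => i; case: (unliftP ord0 i) => [j|] ->.
  by rewrite rV_consS mxE.
by rewrite rV_cons0.
Qed.

Lemma measurable_rV_cons n : measurable_fun setT (@rV_cons n).
Proof.
apply: measurable_fun_rV => i; case: (unliftP ord0 i) => [j|] ->.
  under eq_fun do rewrite rV_consS.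
  apply: (measurableT_comp (measurable_rV_coord j)).
  exact: measurable_snd.
under eq_fun do rewrite rV_cons0.
exact: measurable_fst.
Qed.

Lemma measurable_rV_uncons n : measurable_fun setT (@rV_uncons n).
Proof.
apply/measurable_fun_pairP; split; first exact: measurable_rV_coord.
apply: measurable_fun_rV => i /=.
under eq_fun do rewrite mxE.
exact: measurable_rV_coord.
Qed.

Section step.
Variables (n : nat) (mu : {sigma_finite_measure set 'rV[R]_n -> \bar R}).

Definition lebesgue_rV_step : set 'rV[R]_n.+1 -> \bar R :=
  pushforward (lebesgue_measure \x mu)%E (@rV_cons n).

Let step0 : lebesgue_rV_step set0 = 0%E.
Proof. by rewrite /lebesgue_rV_step /pushforward preimage_set0 measure0. Qed.

Let step_ge0 A : (0 <= lebesgue_rV_step A)%E.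
Proof. by rewrite /lebesgue_rV_step /pushforward; exact: measure_ge0. Qed.

Let step_sigma_additive : semi_sigma_additive lebesgue_rV_step.
Proof.
move=> F mF tF mUF; rewrite /lebesgue_rV_step /pushforward preimage_bigcup.
have mpre A : measurable A -> measurable (@rV_cons n @^-1` A).
  by move=> mA; rewrite -[X in measurable X]setTI; exact: measurable_rV_cons.
apply: measure_semi_sigma_additive => [k||]; first exact: mpre.
- apply/trivIsetP => i j _ _ ij; rewrite -preimage_setI.
  by move/trivIsetP : tF => /(_ _ _ _ _ ij) ->//; rewrite preimage_set0.
- by rewrite -preimage_bigcup; exact: mpre.
Qed.

HB.instance Definition _ := isMeasure.Build _ _ _ lebesgue_rV_step
  step0 step_ge0 step_sigma_additive.

Let step_sigma_finite : sigma_finite setT lebesgue_rV_step.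
Proof.
have /sigma_finiteP[F [TF ndF Foo]] := sigma_finiteT (@lebesgue_measure R).
have /sigma_finiteP[G [TG ndG Goo]] := sigma_finiteT mu.
exists (fun k => @rV_uncons n @^-1` (F k `*` G k)).
  apply/esym; rewrite -subTset => x _.
  have [k _ Fk] : (\bigcup_k F k) (rV_uncons x).1 by rewrite -TF.
  have [l _ Gl] : (\bigcup_k G k) (rV_uncons x).2 by rewrite -TG.
  exists (maxn k l) => //; split.
  - by move: Fk; exact/subsetPset/ndF/leq_maxl.
  - by move: Gl; exact/subsetPset/ndG/leq_maxr.
move=> k; have [mF Fk] := Foo k; have [mG Gk] := Goo k; split.
  by rewrite -[X in measurable X]setTI; apply: measurable_rV_uncons => //;
    exact: measurableX.
rewrite /lebesgue_rV_step /pushforward -comp_preimage.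
rewrite (_ : _ \o _ = id); last by apply/funext => x /=; exact: rV_consK.
by rewrite preimage_id product_measure1E// lte_mul_pinfty// ge0_fin_numE.
Qed.

HB.instance Definition _ := Measure_isSigmaFinite.Build _ _ _ lebesgue_rV_step
  step_sigma_finite.

End step.

(* n-fold product of [lebesgue_measure], transported to row vectors. *)
Fixpoint lebesgue_rV n : {sigma_finite_measure set 'rV[R]_n -> \bar R} :=
  if n is n'.+1 then lebesgue_rV_step (lebesgue_rV n')
  else \d_(0 : 'rV[R]_0).

(* This characterizes [lebesgue_rV n] among measures on ['rV[R]_n]. *)
Lemma lebesgue_rV_box n (A : 'I_n -> set R) : (forall i, measurable (A i)) ->
  lebesgue_rV n [set x | forall i, A i (x ord0 i)] =
  (\prod_(i < n) lebesgue_measure (A i))%E.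
Proof.
elim: n A => [|n IH] A mA.
  by rewrite big_ord0 /= diracE mem_set// => -[].
rewrite big_ord_recl -IH//= /lebesgue_rV_step /pushforward.
rewrite -product_measure1E; [|exact: mA|
  by apply: (@measurable_rV_box _ _ n (fun i => A (lift ord0 i))) => i; exact: mA].
congr (_ _); apply/seteqP; split => -[a x]/=.
  by move=> Ax; split => [|i]; [have := Ax ord0|have := Ax (lift ord0 i)];
    rewrite ?rV_cons0 ?rV_consS.
move=> [Aa Ax] i; case: (unliftP ord0 i) => [j|] ->.
  by rewrite rV_consS; exact: Ax.
by rewrite rV_cons0.
Qed.

End lebesgue_measure_rV.

Section calculus.
Context {R : realType} {N : nat}.
Implicit Types (x : 'rV[R]_N) (u : 'rV[R]_N -> R).

(* The library norm on ['rV[R]_N] is the sup norm. *)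
Definition euclidean_norm x : R := Num.sqrt (\sum_(i < N) x ord0 i ^+ 2).

Definition partial (i : 'I_N) u : 'rV[R]_N -> R :=
  fun x => 'D_(delta_mx ord0 i) u x.

Definition iter_partial (s : seq 'I_N) u : 'rV[R]_N -> R := foldr partial u s.

(* C^infinity: all iterated partial derivatives exist and are continuous. *)
Definition smooth u := forall s : seq 'I_N,
  continuous (iter_partial s u) /\
  forall i x, derivable (iter_partial s u) x (delta_mx ord0 i).

Definition compactly_supported u := compact (closure [set x | u x != 0]).

Definition gradient u x : 'rV[R]_N := \row_i partial i u x.

(* On the diagonal the numerator vanishes, so the value is 0 whatever the
   convention for 0 ^ a and 0^-1; hence the diagonal belongs to no level set
   [set z | l <= `|f z|] with 0 < l. *)
Definition difference_quotient (a : R) u (z : 'rV[R]_N * 'rV[R]_N) : R :=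
  (u z.1 - u z.2) / euclidean_norm (z.1 - z.2) `^ a.

End calculus.

Section marcinkiewicz.
Local Open Scope ereal_scope.
Context {d} {T : measurableType d} {R : realType}.

Definition marcinkiewicz_norm (mu : {measure set T -> \bar R}) (p : R)
    (f : T -> R) : \bar R :=
  (ereal_sup [set (l `^ p)%:E * mu [set z | (l <= `|f z|)%R]
             | l in [set l : R | (0 < l)%R]]) `^ p^-1.

End marcinkiewicz.

(* Main.v *)
From HB Require Import structures.
Require Import Defs.
From mathcomp Require Import all_boot all_order all_algebra.
From mathcomp Require Import all_classical all_reals all_analysis.
From mathcomp Require Import measurable_realfun ess_sup_inf zify ring lra.
Import Order.TTheory GRing.Theory Num.Theory.
Import numFieldNormedType.Exports.
Local Open Scope classical_set_scope.
Local Open Scope ring_scope.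

Set Implicit Arguments.
Unset Strict Implicit.
Unset Printing Implicit Defensive.

(** For general [p], [|u x - u y|^p <= (2 |u|_oo)^(p-1) |u x - u y|] reduces
    everything to the weak type estimate for [p = 1]: the set where
    [l |h|^(N+1) <= |u (x + h) - u x|] has measure at most [C/l |grad u|_1].

    Split this set according to the dyadic size [r = r0 / 2^k] of [|h|], and
    move from [x] to [x + h] one coordinate at a time.  Some coordinate [i]
    satisfies [c r^(N+1) <= \int_(|t| <= r) |d_i u (w + t e_i)|], where [w] is
    [x] with its first [i] coordinates shifted by [h].  By translation
    invariance and Tonelli, the pairs with this property have measure
    [(2 r)^N |A|], where [A] is the set of all such [w].

    It remains to bound [sum_k r_k^N |A_k|] by [C/c |d_i u|_1], and by Tonelli
    this can be done on each line parallel to [e_i].  On a line, replace the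
    window of radius [r] by the dyadic cell of length [r] and its two
    neighbours.  The sum over heavy cells is then bounded by a stopping-time
    argument: below a heavy cell of length [r] the series of the
    [(r / 2^j)^N] is geometric, so it is paid for by the mass of that cell
    alone, and maximal heavy cells are disjoint. *)

(** * Weighted indicators and integrals depending on a parameter *)

Lemma integral_sum_indic d (T : measurableType d) (R : realType)
    (mu : {measure set T -> \bar R}) m (w : 'I_m -> R) (A : 'I_m -> set T) :
  (forall k, 0 <= w k) -> (forall k, measurable (A k)) ->
  (\int[mu]_x (\sum_(k < m) w k * \1_(A k) x)%:E =
   \sum_(k < m) (w k)%:E * mu (A k))%E.
Proof.
move=> w0 mA.
under eq_integral do rewrite -sumEFin.
rewrite ge0_integral_sum//; last 2 first.
- by move=> k; apply/measurable_EFinP; apply: measurable_funM.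
- by move=> k x _; rewrite lee_fin mulr_ge0.
apply: eq_bigr => k _; under eq_integral do rewrite EFinM.
rewrite ge0_integralZl_EFin//; last by apply/measurable_EFinP.
by rewrite integral_indic// setIT.
Qed.

(** Extending the integrand by zero outside [D] turns the integral into one over the whole line,
    which is measurable in [x] by Tonelli. *)
Lemma measurable_ge_integral d (T : measurableType d) (R : realType)
    (g : T * R -> \bar R) (D : set R) (a : \bar R) :
  measurable_fun setT g -> (forall z, 0 <= g z)%E -> measurable D ->
  measurable [set x | (a <= \int[lebesgue_measure]_(t in D) g (x, t))%E].
Proof.
move=> mg g0 mD; rewrite -[X in measurable X]setTI.
apply: emeasurable_fun_c_infty => //.
under eq_fun do rewrite integral_mkcond.
have := @measurable_fun_fubini_tonelli_F _ _ _ _ R lebesgue_measure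
  (g \_ (setT `*` D)).
rewrite /fubini_F/= => mint.
apply: (eq_measurable_fun _ _ (mint _ _)) => [x _||z].
- by apply: eq_integral => t _; rewrite /patch in_setX in_setT.
- apply/(measurable_restrictT _ _).1 => //; first exact: measurableX.
  exact: measurable_funTS.
- exact: erestrict_ge0.
Qed.

(** * Heavy dyadic cells and heavy windows on the line *)

Section translation.
Context {R : realType}.
Notation mu := (@lebesgue_measure R).

Definition translate (a : R) (s : measurableTypeR R) : measurableTypeR R := s + a.

Lemma measurable_translate (a : R) : measurable_fun setT (translate a).
Proof. exact: measurable_funD. Qed.

HB.instance Definition _ a := isMeasurableFun.Build _ _ _ _ _ (measurable_translate a).

(** The pushforward is a measure that gives half-open intervals their length, and this determines
    Lebesgue measure. *)
Lemma lebesgue_measure_translate (a : R) (A : set R) : measurable A ->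
  pushforward mu (translate a) A = mu A.
Proof.
move=> mA; apply/esym/lebesgue_measure_unique => //= _ [[b c]] _ <-.
rewrite /pushforward/=.
rewrite (_ : _ @^-1` _ = `]b - a, c - a]%classic); last first.
  by apply/seteqP; split => s /=; rewrite !in_itv/= /translate ltrBlDr lerBrDr.
rewrite !lebesgue_measure_itv/= !lte_fin ltrD2r; case: ifPn => // _.
by rewrite -!EFinB; congr EFin; ring.
Qed.

Lemma ge0_integral_translate (a : R) (f : R -> \bar R) :
  measurable_fun setT f -> (forall s, 0 <= f s)%E ->
  (\int[mu]_s f (s + a)%R = \int[mu]_s f s)%E.
Proof.
move=> mf f0.
have := @ge0_integral_pushforward _ _ _ _ R _ (measurable_translate a)
  mu setT f measurableT mf.
rewrite preimage_setT => <- //.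
by apply: eq_measure_integral => //= A mA _; exact: lebesgue_measure_translate.
Qed.

End translation.

(** * Dyadic cells and the stopping-time bound on a line *)

Section dyadic_stopping.
Context {R : realType}.
Notation mu := (@lebesgue_measure R).
Variables (F : R -> \bar R) (c : R) (N : nat).
Hypotheses (mF : measurable_fun setT F) (F0 : forall s, (0 <= F s)%E).
Hypotheses (c0 : 0 < c) (N0 : (0 < N)%N).

Definition dyadic_cell (r : R) (j : int) : set R := `[j%:~R * r, (j + 1)%:~R * r[.

Lemma measurable_dyadic_cell r j : measurable (dyadic_cell r j).
Proof. exact: measurable_itv. Qed.

Lemma dyadic_cellP r j s : 0 < r -> dyadic_cell r j s <-> Num.floor (s / r) = j.
Proof.
move=> r0; rewrite /dyadic_cell/= in_itv/= -ler_pdivlMr// -ltr_pdivrMr//.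
split=> [/floor_def//|<-]; exact: floor_itv.
Qed.

Lemma dyadic_cell_split r j : 0 < r ->
  dyadic_cell r j = dyadic_cell (r / 2) (2 * j) `|` dyadic_cell (r / 2) (2 * j + 1).
Proof.
move=> r0; rewrite /dyadic_cell.
have -> : j%:~R * r = (2 * j)%:~R * (r / 2) by rewrite intrM; field.
have -> : (j + 1)%:~R * r = (2 * j + 1 + 1)%:~R * (r / 2).
  by rewrite !intrD intrM; field.
rewrite (@itv_bndbnd_setU _ _ _ (BLeft ((2 * j + 1)%:~R * (r / 2))))//;
  by rewrite bnd_simp ler_pM2r ?divr_gt0// ler_int; lia.
Qed.

Lemma disjoint_dyadic_cell r j k : 0 < r -> j <> k ->
  [disjoint dyadic_cell r j & dyadic_cell r k].
Proof.
move=> r0 jk; rewrite disj_set2E; apply/eqP/seteqP; split=> // s [].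
by move=> /(dyadic_cellP _ _ r0) + /(dyadic_cellP _ _ r0) => ->.
Qed.

Lemma lebesgue_measure_dyadic_cell r j : 0 < r -> mu (dyadic_cell r j) = r%:E.
Proof.
move=> r0; rewrite /dyadic_cell lebesgue_measure_itv/= lte_fin ltr_pM2r// ltr_int ltrDl.
by rewrite -EFinD; congr EFin; rewrite intrD; ring.
Qed.

(** The integral depends on [s] only through its cell, so this set is a union of cells of length
    [r]. *)
Definition heavy_cell (r : R) : set R := [set s |
  ((c * r ^+ N.+1)%:E <= \int[mu]_(t in dyadic_cell r (Num.floor (s / r))) F t)%E].

Lemma measurable_heavy_cell r : 0 < r -> measurable (heavy_cell r).
Proof.
move=> r0; pose P (j : int) : set R :=
  if ((c * r ^+ N.+1)%:E <= \int[mu]_(t in dyadic_cell r j) F t)%E then dyadic_cell r j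
  else set0.
rewrite (_ : heavy_cell r = \bigcup_j P j).
  apply: countable_bigcupT_measurable => [|j]; first exact: countableP.
  by rewrite /P; case: ifP => _ //; exact: measurable_dyadic_cell.
apply/seteqP; split => [s ds|s [j _]].
  by exists (Num.floor (s / r)) => //; rewrite /P ifT//; exact/dyadic_cellP.
by rewrite /P; case: ifP => // ? /(dyadic_cellP _ _ r0); rewrite /heavy_cell/= => ->.
Qed.

(** Its integral is the sum of r_k^N times the measure of the heavy set at scale r_k = r / 2^k.
    Cutting at [m] scales permits an induction that starts from any [r]. *)
Definition cell_weight m r (s : R) : R :=
  \sum_(k < m) (r / 2 ^+ k) ^+ N * \1_(heavy_cell (r / 2 ^+ k)) s.

Lemma cell_weightS m r s :
  cell_weight m.+1 r s = r ^+ N * \1_(heavy_cell r) s + cell_weight m (r / 2) s.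
Proof.
rewrite /cell_weight big_ord_recl/= expr0 divr1; congr (_ + _).
apply: eq_bigr => k _.
by rewrite (_ : r / 2 ^+ lift ord0 k = r / 2 / 2 ^+ k)// lift0 exprS invfM mulrA.
Qed.

Lemma cell_weight_ge0 m r s : 0 <= r -> 0 <= cell_weight m r s.
Proof.
by move=> r0; apply: sumr_ge0 => k _; rewrite mulr_ge0// exprn_ge0// divr_ge0// exprn_ge0.
Qed.

(** A geometric series of ratio 2^-N: since [N0] gives 2 <= 2^N, the tail starting at [r / 2] is at
    most r^N. *)
Lemma cell_weight_le m r s : 0 <= r -> cell_weight m r s <= 2 * r ^+ N.
Proof.
elim: m r => [|m IH] r r0.
  by rewrite /cell_weight big_ord0 mulr_ge0// exprn_ge0.
rewrite cell_weightS mulr2n mulrDl !mul1r lerD//.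
  by rewrite ler_piMr ?exprn_ge0// indicE; case: (_ \in _).
apply: le_trans (IH _ _) _; first by rewrite divr_ge0.
rewrite expr_div_n mulrCA ler_piMr ?exprn_ge0// ler_pdivrMr ?exprn_gt0// mul1r.
by rewrite -[leLHS]expr1 ler_weXn2l// ler1n.
Qed.

Lemma measurable_cell_weight m r : 0 < r -> measurable_fun setT (cell_weight m r).
Proof.
move=> r0; apply: measurable_sum => k; apply: measurable_funM => //.
by apply: measurable_indic; apply: measurable_heavy_cell; rewrite divr_gt0// exprn_gt0.
Qed.

(** Induction on the number of scales, over all cells at once because the halves of a cell have
    another [r] and [j]. The constant compares 2 r^N * r, an upper bound for the left side, with the
    mass of a heavy cell, at least c r^(N+1). *)
Lemma cell_weight_cell_integral m r j : 0 < r ->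
  (\int[mu]_(s in dyadic_cell r j) (cell_weight m r s)%:E <=
   (2 / c)%:E * \int[mu]_(s in dyadic_cell r j) F s)%E.
Proof.
have mFj r' j' : measurable_fun (dyadic_cell r' j') F by exact: measurable_funTS.
have IF0 r' j' : (0 <= \int[mu]_(s in dyadic_cell r' j') F s)%E by exact: integral_ge0.
have c20 : 0 <= 2 / c by rewrite divr_ge0// ltW.
have mS n r' D : 0 < r' -> measurable_fun D (EFin \o cell_weight n r').
  by move=> r'0; apply/measurable_EFinP; apply: measurable_funTS; exact: measurable_cell_weight.
elim: m r j => [|m IH] r j r0.
  rewrite (eq_integral (cst 0%E)) => [|s _]; last by rewrite /cell_weight big_ord0.
  by rewrite integral0 mule_ge0// lee_fin.
have r20 : 0 < r / 2 by rewrite divr_gt0.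
(* A heavy root cell absorbs the whole geometric series; a light one contributes
   nothing itself, and its two halves are handled by induction. *)
have [good|bad] := leP (c * r ^+ N.+1)%:E (\int[mu]_(s in dyadic_cell r j) F s)%E.
  apply: (@le_trans _ _ (\int[mu]_(s in dyadic_cell r j) (2 * r ^+ N)%:E)%E).
    apply: ge0_le_integral => //=; first exact: measurable_dyadic_cell.
    - by move=> s _; rewrite lee_fin cell_weight_ge0// ltW.
    - exact: mS.
    - by move=> s _; rewrite lee_fin cell_weight_le// ltW.
  rewrite integral_cst; last exact: measurable_dyadic_cell.
  rewrite [X in (_ * X)%E](lebesgue_measure_dyadic_cell j r0).
  apply: le_trans (lee_wpmul2l _ good); last by rewrite lee_fin.
  rewrite -!EFinM lee_fin exprSr (_ : 2 / c * _ = 2 * r ^+ N * r)//.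
  by field; rewrite gt_eqF.
have -> : (\int[mu]_(s in dyadic_cell r j) (cell_weight m.+1 r s)%:E =
             \int[mu]_(s in dyadic_cell r j) (cell_weight m (r / 2) s)%:E)%E.
  apply: eq_integral => s /set_mem/dyadic_cellP-/(_ r0) sj.
  rewrite cell_weightS indicE memNset ?mulr0 ?add0r// /heavy_cell/= sj.
  by apply/negP; rewrite -ltNge.
rewrite (dyadic_cell_split j r0) !ge0_integral_setU//; do 1?[exact: measurable_dyadic_cell].
all: try exact: measurable_funTS.
all: try exact: mS.
all: try by apply: disjoint_dyadic_cell => //; lia.
  by rewrite ge0_muleDr// leeD// IH.
by move=> s _; rewrite lee_fin cell_weight_ge0// ltW.
Qed.

(** The cells partition the line. They are numbered by [pickle], and a number that codes no integer
    contributes the empty set. *)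
Lemma ge0_integral_dyadic_cells (G : R -> \bar R) (r : R) : 0 < r ->
  measurable_fun setT G -> (forall s, (0 <= G s)%E) ->
  (\int[mu]_s G s = \sum_(k <oo) if (pickle_inv k : option int) is Some j
     then \int[mu]_(s in dyadic_cell r j) G s else 0)%E.
Proof.
move=> r0 mG G0.
pose P k : set R := if (pickle_inv k : option int) is Some j then dyadic_cell r j else set0.
have -> : [set: R] = \bigcup_k P k.
  apply/esym; rewrite -subTset => s _.
  exists (pickle (Num.floor (s / r))); first exact: I.
  by rewrite /P pickleK_inv; exact/dyadic_cellP.
rewrite ge0_integral_bigcup//.
- by apply: eq_eseriesr => k _; rewrite /P; case: pickle_inv => //; rewrite integral_set0.
- by move=> k; rewrite /P; case: pickle_inv => // j; exact: measurable_dyadic_cell.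
- exact: measurable_funTS.
- apply/trivIsetP => k l _ _; apply: contra_neqP => /eqP/set0P[s []].
  rewrite /P; have := @pickle_invK int k; have := @pickle_invK int l.
  case: pickle_inv => //= i <-; case: pickle_inv => //= j <-.
  by move=> /(dyadic_cellP _ _ r0) <- /(dyadic_cellP _ _ r0) <-.
Qed.

Lemma cell_weight_integral m r : 0 < r ->
  (\int[mu]_s (cell_weight m r s)%:E <= (2 / c)%:E * \int[mu]_s F s)%E.
Proof.
move=> r0; rewrite !(@ge0_integral_dyadic_cells _ r r0)//; last 2 first.
- by apply/measurable_EFinP; exact: measurable_cell_weight.
- by move=> s; rewrite lee_fin cell_weight_ge0// ltW.
rewrite -nneseriesZl//=; last first.
  by move=> k _; case: pickle_inv => // j; exact: integral_ge0.
apply: lee_nneseries => [k _ _|k _].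
  case: pickle_inv => // j; apply: integral_ge0 => s _.
  by rewrite lee_fin cell_weight_ge0// ltW.
by case: pickle_inv => [j|]; [exact: cell_weight_cell_integral|rewrite mule0].
Qed.

End dyadic_stopping.

(** * From dyadic cells to centred windows *)

Section heavy_windows.
Context {R : realType}.
Notation mu := (@lebesgue_measure R).
Variables (F : R -> \bar R) (c : R) (N : nat).
Hypotheses (mF : measurable_fun setT F) (F0 : forall s, (0 <= F s)%E).
Hypotheses (c0 : 0 < c) (N0 : (0 < N)%N).

Definition heavy_window (r : R) : set R := [set s |
  ((c * r ^+ N.+1)%:E <= \int[mu]_(t in `[(- r)%R, r]) F (s + t)%R)%E].

Lemma measurable_heavy_window r : measurable (heavy_window r).
Proof.
have mF2 : measurable_fun setT (fun z : measurableTypeR R * R => F (z.1 + z.2)).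
  by apply: measurableT_comp => //; exact: measurable_funD.
exact: (@measurable_ge_integral _ _ _ _ _ _ mF2).
Qed.

Lemma integral_window (s r : R) :
  (\int[mu]_(t in `[(- r)%R, r]) F (s + t)%R =
   \int[mu]_(t in `[(s - r)%R, (s + r)%R]) F t)%E.
Proof.
have winE (t : R) : (- r <= t <= r) = (s - r <= t + s <= s + r).
  by apply/idP/idP => /andP[? ?]; apply/andP; split; lra.
rewrite integral_mkcond [RHS]integral_mkcond.
rewrite -(ge0_integral_translate s (f := F \_ `[s - r, s + r])).
- apply: eq_integral => t _; rewrite /patch !mem_setE !in_itv/= (addrC s t).
  congr (if _ then _ else _); exact: winE.
- by apply/(measurable_restrictT _ _).1 => //; exact: measurable_funTS.
- by move=> t; exact: erestrict_ge0.
Qed.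

(** The window lies in the union of the cell of [s] and its two neighbours, so one of the three
    carries at least a third of the mass. That a neighbour is heavy is expressed by moving [s] into
    it by [r]. *)
Lemma heavy_window_sub r : 0 < r -> heavy_window r `<=`
  translate (- r) @^-1` heavy_cell F (c / 3) N r `|` heavy_cell F (c / 3) N r `|`
  translate r @^-1` heavy_cell F (c / 3) N r.
Proof.
move=> r0 s; rewrite /heavy_window/= integral_window => hs.
have floorD (k : int) : Num.floor ((s + k%:~R * r) / r) = Num.floor (s / r) + k.
  by rewrite mulrDl mulfK ?gt_eqF// floorDrz ?intr_int// intrKfloor.
have fm : Num.floor (translate (- r) s / r) = Num.floor (s / r) - 1.
  by rewrite -(floorD (-1)) /translate mulN1r.
have fp : Num.floor (translate r s / r) = Num.floor (s / r) + 1.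
  by rewrite -(floorD 1) /translate mul1r.
rewrite /heavy_cell/= fm fp; set j := Num.floor (s / r) in fm fp *.
have mFj r' j' : measurable_fun (dyadic_cell r' j') F by exact: measurable_funTS.
set I := (fun k => \int[mu]_(t in dyadic_cell r k) F t)%E.
have hI : ((c * r ^+ N.+1)%:E <= I (j - 1)%R + I j + I (j + 1)%R)%E.
  have d1 : [disjoint dyadic_cell r (j - 1) & dyadic_cell r j].
    by apply: disjoint_dyadic_cell => //; lia.
  have d2 : [disjoint dyadic_cell r (j - 1) `|` dyadic_cell r j & dyadic_cell r (j + 1)].
    rewrite disj_set2E setIUl; apply/eqP/seteqP; split=> // t.
    by case=> -[] /(dyadic_cellP _ _ r0) + /(dyadic_cellP _ _ r0) => ->; lia.
  apply: le_trans hs _; rewrite /I -!ge0_integral_setU//.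
  all: try exact: measurable_dyadic_cell.
  all: try exact: measurable_funTS.
    apply: ge0_subset_integral => //.
    - by apply: measurableU; [apply: measurableU|]; exact: measurable_dyadic_cell.
    - exact: measurable_funTS.
    move=> t /=; rewrite in_itv/= => /andP[rt tr].
    have : dyadic_cell r j s by exact/dyadic_cellP.
    (* From j r <= s < (j + 1) r, the closed window lies in [(j - 1) r, (j + 2) r[; the strict bound
       on [s] takes care of the right end. *)
    rewrite /dyadic_cell/= !in_itv/= !intrD !mulrDl mul1r mulN1r => /andP[js sj].
    have [h1|h1] := ltP t (j%:~R * r).
      by left; left; apply/andP; split; lra.
    have [h2|h2] := ltP t (j%:~R * r + r).
      by left; right; apply/andP; split; lra.
    by right; apply/andP; split; lra.
  by apply: measurableU; exact: measurable_dyadic_cell.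
have [h1|h1] := leP (c / 3 * r ^+ N.+1)%:E (I (j - 1)); first by left; left.
have [h2|h2] := leP (c / 3 * r ^+ N.+1)%:E (I j); first by left; right.
have [h3|h3] := leP (c / 3 * r ^+ N.+1)%:E (I (j + 1)); first by right.
have := lteD (lteD h1 h2) h3; rewrite -!EFinD ltNge.
by rewrite (_ : _ + _ = c * r ^+ N.+1) ?hI//; field.
Qed.

Lemma lebesgue_measure_heavy_window r : 0 < r ->
  (mu (heavy_window r) <= 3%:E * mu (heavy_cell F (c / 3) N r))%E.
Proof.
move=> r0; set A := heavy_cell _ _ _ _.
have mA : measurable A by exact: measurable_heavy_cell.
have mtr a : measurable (translate a @^-1` A).
  by rewrite -[X in measurable X]setTI; exact: measurable_translate.
have mAA : measurable (translate (- r) @^-1` A `|` A) by exact: measurableU.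
have trA a : mu (translate a @^-1` A) = mu A by exact: lebesgue_measure_translate.
have -> : (3%:E * mu A = mu (translate (- r) @^-1` A) + mu A + mu (translate r @^-1` A))%E.
  rewrite (trA (- r)) (trA r) mule_natl.
  by rewrite muleS mule2n addeA.
apply: (@le_trans _ _ (mu (translate (- r) @^-1` A `|` A `|` translate r @^-1` A))).
  apply: (le_measure mu _ _ (heavy_window_sub r0)); rewrite inE.
    exact: measurable_heavy_window.
  exact: measurableU.
apply: le_trans (measureU2 mu mAA (mtr r)) _.
exact: leeD (measureU2 mu (mtr (- r)) mA) (lexx _).
Qed.

(* 18 = 3 * 2 * 3: three neighbouring cells, the geometric series, and the fact
   that one of the three cells carries at least a third of the mass. *)
Lemma heavy_window_integral m r : 0 < r ->
  (\int[mu]_s (\sum_(k < m) (r / 2 ^+ k) ^+ N * \1_(heavy_window (r / 2 ^+ k)) s)%:E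
   <= (18 / c)%:E * \int[mu]_s F s)%E.
Proof.
move=> r0; have rk k : 0 < r / 2 ^+ k by rewrite divr_gt0// exprn_gt0.
have w0 (k : 'I_m) : 0 <= (r / 2 ^+ k) ^+ N by rewrite exprn_ge0// ltW.
rewrite integral_sum_indic//; last by move=> k; exact: measurable_heavy_window.
have c30 : 0 < c / 3 by rewrite divr_gt0.
have mD k : measurable (heavy_cell F (c / 3) N (r / 2 ^+ k)) by exact: measurable_heavy_cell.
apply: (@le_trans _ _ (3%:E * \int[mu]_s (cell_weight F (c / 3) N m r s)%:E)%E).
  rewrite integral_sum_indic//; last by move=> k; exact: mD.
  rewrite ge0_sume_distrr; last first.
    by move=> k _; rewrite mule_ge0// lee_fin.
  apply: lee_sum => k _; rewrite muleCA; apply: lee_wpmul2l; first by rewrite lee_fin.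
  exact: lebesgue_measure_heavy_window.
have -> : ((18 / c)%:E = 3%:E * (2 / (c / 3))%:E :> \bar R)%E.
  by rewrite -EFinM; congr EFin; field; rewrite gt_eqF.
rewrite -muleA; apply: lee_wpmul2l => //.
exact: cell_weight_integral.
Qed.

End heavy_windows.

(** * Integration over row vectors *)

Section rV_integral.
Context {R : realType}.
Notation mu := (@lebesgue_measure R).

(** [lebesgue_rV n.+1] is by construction the image of a product measure under [rV_cons], so Tonelli
    separates the first coordinate. *)
Lemma ge0_integral_rVS n (f : 'rV[R]_n.+1 -> \bar R) :
  measurable_fun setT f -> (forall x, 0 <= f x)%E ->
  (\int[lebesgue_rV n.+1]_x f x =
   \int[mu]_a \int[lebesgue_rV n]_x f (rV_cons (a, x)))%E.
Proof.
move=> mf f0.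
have mfc : measurable_fun setT (f \o @rV_cons R n).
  by apply: (measurableT_comp mf); exact: measurable_rV_cons.
rewrite -(fubini_tonelli1 (m1 := mu) (m2 := lebesgue_rV n) _ mfc); last first.
  by move=> z; exact: f0.
have := @ge0_integral_pushforward _ _ _ _ R _ (@measurable_rV_cons R n)
  (lebesgue_measure \x lebesgue_rV n)%E setT f measurableT mf.
by rewrite preimage_setT => <-.
Qed.

Lemma rV_consD n (a b : R) (x y : 'rV[R]_n) :
  rV_cons (a + b, x + y) = rV_cons (a, x) + rV_cons (b, y).
Proof.
apply/rowP => i; case: (unliftP ord0 i) => [j|] ->.
  by rewrite [RHS]mxE !rV_consS mxE.
by rewrite [RHS]mxE !rV_cons0.
Qed.

Lemma measurable_rV_cons_head n (a : R) :
  measurable_fun setT (fun x : 'rV[R]_n => rV_cons (a, x)).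
Proof.
apply: (measurableT_comp (@measurable_rV_cons R n)).
exact: measurable_pair1.
Qed.

Lemma measurable_rV_add n (h : 'rV[R]_n) : measurable_fun setT (fun x : 'rV[R]_n => x + h).
Proof.
apply: measurable_fun_rV => i; under eq_fun do rewrite mxE.
by apply: measurable_funD => //; exact: measurable_rV_coord.
Qed.

(** Induction on the dimension: the tail is shifted by the induction hypothesis, the first
    coordinate by translation invariance on the line. *)
Lemma ge0_integral_rV_translate n (h : 'rV[R]_n) (f : 'rV[R]_n -> \bar R) :
  measurable_fun setT f -> (forall x, 0 <= f x)%E ->
  (\int[lebesgue_rV n]_x f (x + h)%R = \int[lebesgue_rV n]_x f x)%E.
Proof.
elim: n h f => [|n IH] h f mf f0.
  by apply: eq_integral => x _; congr f; rewrite [h]thinmx0 addr0.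
have mfh : measurable_fun setT (fun x : 'rV[R]_n.+1 => f (x + h)).
  by apply: (measurableT_comp mf); exact: measurable_rV_add.
rewrite [LHS](ge0_integral_rVS mfh); last by move=> x; exact: f0.
rewrite [RHS](ge0_integral_rVS mf f0).
have hE : rV_cons (h ord0 ord0, (rV_uncons h).2) = h := rV_unconsK h.
pose g a := (\int[lebesgue_rV n]_x f (rV_cons (a, x)))%E.
transitivity (\int[mu]_a g (a + h ord0 ord0)%R)%E.
  apply: eq_integral => a _; rewrite /g -[RHS](IH (rV_uncons h).2)//.
    by apply: eq_integral => x _; rewrite rV_consD hE.
  by apply: (measurableT_comp mf); exact: measurable_rV_cons_head.
rewrite ge0_integral_translate//; last by move=> a; exact: integral_ge0.
have mfc : measurable_fun setT (f \o @rV_cons R n).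
  by apply: (measurableT_comp mf); exact: measurable_rV_cons.
exact: (measurable_fun_fubini_tonelli_F (m2 := lebesgue_rV n) _ mfc (fun z => f0 _)).
Qed.

(** The coordinates before [i] are frozen one by one by induction. Once [i] is the first coordinate,
    Tonelli exchanges the integrals, so that the one along the line becomes the inner one. *)
Lemma integral_rV_line_le n (i : 'I_n) (f g : 'rV[R]_n -> \bar R) :
  measurable_fun setT f -> (forall x, 0 <= f x)%E ->
  measurable_fun setT g -> (forall x, 0 <= g x)%E ->
  (forall x, \int[mu]_t f (x + t *: delta_mx ord0 i)%R <=
             \int[mu]_t g (x + t *: delta_mx ord0 i)%R)%E ->
  (\int[lebesgue_rV n]_x f x <= \int[lebesgue_rV n]_x g x)%E.
Proof.
elim: n i f g => [[]//|n IH] i f g mf f0 mg g0 fg.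
have mfc : measurable_fun setT (f \o @rV_cons R n).
  by apply: (measurableT_comp mf); exact: measurable_rV_cons.
have mgc : measurable_fun setT (g \o @rV_cons R n).
  by apply: (measurableT_comp mg); exact: measurable_rV_cons.
rewrite (ge0_integral_rVS mf f0) (ge0_integral_rVS mg g0).
have deltaS (j : 'I_n) :
    delta_mx ord0 (lift ord0 j) = rV_cons (0, delta_mx ord0 j) :> 'rV[R]_n.+1.
  apply/rowP => k; case: (unliftP ord0 k) => [l|] ->.
    by rewrite rV_consS !mxE (inj_eq lift_inj).
  by rewrite rV_cons0 mxE.
have delta0 : delta_mx ord0 ord0 = rV_cons (1, 0) :> 'rV[R]_n.+1.
  apply/rowP => k; case: (unliftP ord0 k) => [l|] ->.
    by rewrite rV_consS !mxE.
  by rewrite rV_cons0 mxE.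
have scale (t : R) p : t *: rV_cons p = rV_cons (t * p.1, t *: p.2) :> 'rV[R]_n.+1.
  apply/rowP => k; case: (unliftP ord0 k) => [l|] ->.
    by rewrite [LHS]mxE !rV_consS mxE.
  by rewrite [LHS]mxE !rV_cons0.
case: (unliftP ord0 i) => [j|] ij; rewrite {}ij in fg.
  have step (t a : R) (x : 'rV[R]_n) : rV_cons (a, x) + t *: delta_mx ord0 (lift ord0 j) =
      rV_cons (a, x + t *: delta_mx ord0 j).
    by rewrite deltaS scale -rV_consD mulr0 addr0.
  apply: ge0_le_integral => //.
  - by move=> a _; exact: integral_ge0.
  - by apply: (measurable_fun_fubini_tonelli_F (m2 := lebesgue_rV n) _ mfc) => z; exact: f0.
  - by apply: (measurable_fun_fubini_tonelli_F (m2 := lebesgue_rV n) _ mgc) => z; exact: g0.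
  move=> a _; apply: (IH j) => //.
  - by apply: (measurableT_comp mf); exact: measurable_rV_cons_head.
  - by apply: (measurableT_comp mg); exact: measurable_rV_cons_head.
  move=> x; have := fg (rV_cons (a, x)).
  under eq_integral do rewrite step.
  by under [X in (_ <= X)%E -> _]eq_integral do rewrite step.
(* From a base point with first coordinate 0, the parameter on the line is the first coordinate
   itself. *)
have step (t : R) (x : 'rV[R]_n) : rV_cons (0, x) + t *: delta_mx ord0 ord0 = rV_cons (t, x).
  by rewrite delta0 scale -rV_consD mulr1 add0r scaler0 addr0.
rewrite (fubini_tonelli (m1 := mu) (m2 := lebesgue_rV n) _ mfc); last by move=> z; exact: f0.
rewrite (fubini_tonelli (m1 := mu) (m2 := lebesgue_rV n) _ mgc); last by move=> z; exact: g0.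
apply: ge0_le_integral => //.
- by move=> x _; apply: integral_ge0 => a _; exact: f0.
- by apply: (measurable_fun_fubini_tonelli_G (m1 := mu) _ mfc) => z; exact: f0.
- by apply: (measurable_fun_fubini_tonelli_G (m1 := mu) _ mgc) => z; exact: g0.
move=> x _; have := fg (rV_cons (0, x)).
under eq_integral do rewrite step.
by under [X in (_ <= X)%E -> _]eq_integral do rewrite step.
Qed.

End rV_integral.

(** * Sup norm, open sets and essential supremum on row vectors *)

Section rV_topology.
Context {R : realType}.

Lemma rV_norm_le n (x : 'rV[R]_n) (r : R) : 0 <= r ->
  (`|x| <= r) <-> (forall i, `|x ord0 i| <= r).
Proof.
move=> r0; rewrite /Num.norm/= mx_normrE; split.
  by move=> /bigmax_leP[_ xr] i; exact: (xr (ord0, i)).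
by move=> xr; apply/bigmax_leP; split => // -[i j] _ /=; rewrite ord1; exact: xr.
Qed.

Lemma rV_norm_lt n (x : 'rV[R]_n) (r : R) : 0 < r ->
  (`|x| < r) <-> (forall i, `|x ord0 i| < r).
Proof.
move=> r0; rewrite /Num.norm/= mx_normrE; split.
  by move=> /bigmax_ltP[_ xr] i; exact: (xr (ord0, i)).
by move=> xr; apply/bigmax_ltP; split => // -[i j] _ /=; rewrite ord1; exact: xr.
Qed.

Lemma rV_coord_le n (x : 'rV[R]_n) i : `|x ord0 i| <= `|x|.
Proof. exact: (rV_norm_le x (normr_ge0 x)).1. Qed.

(** The sigma-algebra is generated by the coordinates, so [U] is written as the countable union of
    the boxes with rational centre and half-side 1/(k+1) that it contains. *)
Lemma measurable_rV_open n (U : set 'rV[R]_n) : open U -> measurable U.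
Proof.
move=> oU.
pose I (q : rat) (k : nat) : set R := `]ratr q - k.+1%:R^-1, ratr q + k.+1%:R^-1[%classic.
have I_dist q k t : I q k t <-> `|t - ratr q| < k.+1%:R^-1.
  by rewrite /I/= in_itv/= ltr_distl.
pose B (qk : 'rV[rat]_n * nat) : set 'rV[R]_n :=
  [set x | forall i, I (qk.1 ord0 i) qk.2 (x ord0 i)].
pose C qk := if `[< B qk `<=` U >] then B qk else set0.
have -> : U = \bigcup_qk C qk.
  apply/seteqP; split=> [x Ux|x [qk _]]; last first.
    by rewrite /C; case: ifPn => // /asboolP; exact.
  have /nbhs_ballP[e /= e0 eU] := open_nbhs_nbhs (conj oU Ux).
  (* Two points of a box at level [k] differ by less than 2/(k+1) < e in each coordinate. *)
  pose k := Num.trunc (2 / e).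
  have ke : 2 / e < k.+1%:R by exact: truncnS_gt.
  have k2 : k.+1%:R^-1 + k.+1%:R^-1 < e.
    rewrite (_ : _ + _ = 2 / k.+1%:R); last by ring.
    by rewrite ltr_pdivrMr// mulrC -ltr_pdivrMr.
  have /choice[q qP] : forall i : 'I_n, exists q : rat, I q k (x ord0 i).
    move=> i; have [|q] := @rat_in_itvoo R (x ord0 i - k.+1%:R^-1) (x ord0 i + k.+1%:R^-1).
      by rewrite ltrD2l gtrN.
    by rewrite in_itv/= => qx; exists q; apply/I_dist; rewrite distrC ltr_distl.
  exists (\row_i q i, k); first by [].
  have Bx : B (\row_i q i, k) x by move=> i /=; rewrite mxE; exact: qP.
  rewrite /C ifT//; apply/asboolP => y By; apply: eU.
  rewrite -ball_normE /ball_/=; apply/rV_norm_lt => // i.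
  have /I_dist yq := By i; have /I_dist xq := Bx i.
  rewrite !mxE; move: yq xq; rewrite /= mxE => yq xq.
  rewrite (_ : _ - _ = (x ord0 i - ratr (q i)) - (y ord0 i - ratr (q i))); last by ring.
  by rewrite (le_lt_trans (ler_normB _ _))// (lt_trans _ k2)// ltrD.
apply: countable_bigcupT_measurable => [|qk]; first exact: countableP.
rewrite /C; case: ifP => _ //.
by apply: (measurable_rV_box (A := fun i => I (qk.1 ord0 i) qk.2)) => i; exact: measurable_itv.
Qed.

Lemma continuous_measurable_rV n (u : 'rV[R]_n -> R) : continuous u -> measurable_fun setT u.
Proof.
move=> cu; apply: (measurability _ (RGenOpens.measurableE R)) => _ [_ [a [b ->] <-]].
rewrite setTI; apply: measurable_rV_open; apply: open_comp => // x _; exact: cu.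
Qed.

Lemma rV_closed_ballE n (x : 'rV[R]_n) (r : R) : 0 <= r ->
  [set y | `|y - x| <= r] =
  [set y | forall i, `[x ord0 i - r, x ord0 i + r]%classic (y ord0 i)].
Proof.
move=> r0; apply/seteqP; split => y /=.
  by move=> /(rV_norm_le _ r0) yx i; have := yx i; rewrite !mxE in_itv/= ler_distl.
by move=> yx; apply/rV_norm_le => // i; have := yx i; rewrite !mxE in_itv/= ler_distl.
Qed.

Lemma measurable_closed_ball_rV n (x : 'rV[R]_n) (r : R) : 0 <= r ->
  measurable [set y : 'rV[R]_n | `|y - x| <= r].
Proof.
move=> r0; rewrite rV_closed_ballE//.
apply: (measurable_rV_box (A := fun i => `[x ord0 i - r, x ord0 i + r]%classic)) => i.
exact: measurable_itv.
Qed.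

Lemma lebesgue_rV_closed_ball n (x : 'rV[R]_n) (r : R) : 0 <= r ->
  lebesgue_rV n [set y | `|y - x| <= r] = ((2 * r) ^+ n)%:E.
Proof.
move=> r0; rewrite rV_closed_ballE//.
rewrite (lebesgue_rV_box (A := fun i => `[x ord0 i - r, x ord0 i + r]%classic))//.
under eq_bigr => i _.
  rewrite lebesgue_measure_itv/= lte_fin.
  rewrite (_ : (if _ then _ else _) = (2 * r)%:E); last first.
    (* The other branch forces [r = 0], where both values are 0. *)
    case: ifPn => [_|]; first by rewrite -EFinB; congr EFin; ring.
    by rewrite -leNgt => h; congr EFin; lra.
  over.
by rewrite prodEFin prodr_const card_ord.
Qed.

(** The set where |u| exceeds its essential supremum is null, and open by continuity. A nonempty
    open set contains a cube of positive measure, so this set is empty. *)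
Lemma le_Lnormy n (u : 'rV[R]_n -> R) x : continuous u ->
  (`|u x|%:E <= 'N[lebesgue_rV n]_+oo [EFin \o u])%E.
Proof.
move=> cu.
have pos (U : set 'rV[R]_n) y : open U -> U y -> (0 < lebesgue_rV n U)%E.
  move=> oU Uy; have /nbhs_ballP[e /= e0 eU] := open_nbhs_nbhs (conj oU Uy).
  apply: (@lt_le_trans _ _ (lebesgue_rV n [set z | `|z - y| <= e / 2])).
    by rewrite lebesgue_rV_closed_ball ?divr_ge0 ?ltW// lte_fin exprn_gt0// mulr_gt0// divr_gt0.
  apply: le_measure; rewrite ?inE.
  - by apply: measurable_closed_ball_rV; rewrite divr_ge0// ltW.
  - exact: measurable_rV_open.
  move=> z /= zy; apply: eU; rewrite -ball_normE /ball_/= distrC.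
  by rewrite (le_lt_trans zy)// ltr_pdivrMr// ltr_pMr// ltr1n.
(* The norm is the essential supremum only if the whole space has positive measure, hence the side
   condition. *)
rewrite unlock ifT; last exact: (pos _ 0 openT).
rewrite leNgt; apply/negP => lt_sup.
pose V := [set y | (ess_sup (lebesgue_rV n) (abse \o (EFin \o u)) < `|u y|%:E)%E].
have oV : open V.
  case E : (ess_sup _ _) lt_sup => [M| |]//; rewrite /V E.
    rewrite lte_fin => _.
    rewrite (_ : [set _ | _] = (fun y => `|u y|) @^-1` [set z | M < z]).
      apply: open_comp; last exact: open_gt.
      by move=> y _; apply: continuous_comp; [exact: cu|exact: norm_continuous].
    by apply/seteqP; split => y /=; rewrite lte_fin.
  move=> _; rewrite (_ : mkset _ = setT); first exact: openT.
  by apply/seteqP; split => y //= _; rewrite ltNyr.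
have := pos V x oV lt_sup; rewrite lt0e => /andP[/eqP]; case.
have [A [mA A0 VA]] := ess_sup_ge (lebesgue_rV n) (abse \o (EFin \o u)).
apply/eqP; rewrite eq_le measure_ge0 andbT -A0; apply: le_measure; rewrite ?inE//.
  exact: measurable_rV_open.
by move=> y Vy; apply: VA => /= /le_lt_trans/(_ Vy); rewrite ltxx.
Qed.

End rV_topology.

(** * Increments along coordinate lines *)

Section line_derivative.
Context {R : realType} {n : nat}.
Notation mu := (@lebesgue_measure R).
Implicit Types (u : 'rV[R]_n -> R) (x e : 'rV[R]_n).

Lemma is_derive_line u x e (t : R) : derivable u (x + t *: e) e ->
  is_derive t (1 : R) (fun s : R => u (x + s *: e)) ('D_e u (x + t *: e)).
Proof.
move=> du.
have E : (fun h => h^-1 *: (((fun s => u (x + s *: e)) \o shift t) (h *: 1) - u (x + t *: e))) =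
  (fun h => h^-1 *: ((u \o shift (x + t *: e)) (h *: e) - u (x + t *: e))).
  apply/funext => h /=; congr (_ *: (u _ - _)).
  by rewrite [h *: 1]mulr1 scalerDl addrCA.
by split; rewrite /derivable /derive E.
Qed.

(** The fundamental theorem of calculus for [F], whose derivative [f] is continuous. *)
Lemma line_increment_le u (i : 'I_n) x (a b : R) : a < b ->
  (forall y, derivable u y (delta_mx ord0 i)) -> continuous (partial i u) ->
  (`|u (x + b *: delta_mx ord0 i) - u (x + a *: delta_mx ord0 i)|%:E <=
   \int[mu]_(t in `[a, b]) `|partial i u (x + t *: delta_mx ord0 i)|%:E)%E.
Proof.
move=> ab du cdu; set e := delta_mx ord0 i in du *.
pose f t := partial i u (x + t *: e); pose F t := u (x + t *: e).
have dF (t : R) : is_derive t (1 : R) F (f t) by exact: is_derive_line.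
have cline : continuous (fun t : R => x + t *: e).
  move=> t; apply: cvgD; first exact: cvg_cst.
  by apply: cvgZl; exact: cvg_id.
have cf : continuous f by move=> t; apply: continuous_comp; [exact: cline|exact: cdu].
have cF : continuous F.
  move=> t; apply: differentiable_continuous; apply/derivable1_diffP.
  by have [] := dF t.
have dLR : derivable_oo_LRcontinuous F a b.
  split; first by move=> t _; have [] := dF t.
    by apply: cvg_at_right_filter; exact: cF.
  by apply: cvg_at_left_filter; exact: cF.
have F'f : {in `]a, b[, derive1 F =1 f} by move=> t _; rewrite derive1E; have [] := dF t.
have FTC := continuous_FTC2 ab (continuous_subspaceT cf) dLR F'f.
rewrite -[X in (X <= _)%E]/(`|(F b - F a)%:E|)%E EFinB -FTC.
apply: le_trans (le_abse_integral _ _ _) _ => //.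
by apply: measurable_funTS; apply/measurable_EFinP; exact: continuous_measurable_fun.
Qed.

(** Whatever the sign of [h], the segment between 0 and [h] lies in the window. *)
Lemma window_increment_le u (i : 'I_n) x (r h : R) : `|h| <= r ->
  (forall y, derivable u y (delta_mx ord0 i)) -> continuous (partial i u) ->
  (`|u (x + h *: delta_mx ord0 i) - u x|%:E <=
   \int[mu]_(t in `[(- r)%R, r]) `|partial i u (x + t *: delta_mx ord0 i)|%:E)%E.
Proof.
rewrite ler_norml => /andP[rh hr] du cdu; set e := delta_mx ord0 i in du *.
have x0 : u x = u (x + 0 *: e) by rewrite scale0r addr0.
have cline : continuous (fun t : R => x + t *: e).
  move=> t; apply: cvgD; first exact: cvg_cst.
  by apply: cvgZl; exact: cvg_id.
have mf D : measurable_fun D (fun t : R => `|partial i u (x + t *: e)|%:E).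
  apply: measurable_funTS; apply/measurable_EFinP; apply: measurableT_comp => //.
  apply: continuous_measurable_fun => t.
  by apply: continuous_comp; [exact: cline|exact: cdu].
have sub (a b : R) : -r <= a -> b <= r ->
  (\int[mu]_(t in `[a, b]) `|partial i u (x + t *: e)|%:E <=
   \int[mu]_(t in `[(- r)%R, r]) `|partial i u (x + t *: e)|%:E)%E.
  move=> ra br; apply: ge0_subset_integral => //; first exact: mf.
  move=> t; rewrite /= !in_itv/= => /andP[at_ tb].
  by rewrite (le_trans ra at_) (le_trans tb br).
have [h0|h0|->] := ltgtP h 0.
- rewrite distrC {1}x0; apply: le_trans (line_increment_le x h0 du cdu) _.
  by apply: sub => //; lra.
- rewrite x0; apply: le_trans (line_increment_le x h0 du cdu) _.
  by apply: sub => //; lra.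
- by rewrite x0 subrr normr0; exact: integral_ge0.
Qed.

End line_derivative.

(** * Moving one coordinate at a time *)

Section telescoping.
Context {R : realType} {n : nat}.
Implicit Types (u : 'rV[R]_n -> R) (x h : 'rV[R]_n).

(** The points [x + prefix_rV k h] form the path from [x] to [x + h] along the coordinate
    directions. *)
Definition prefix_rV (k : nat) h : 'rV[R]_n := \row_j (if (j < k)%N then h ord0 j else 0).

Lemma prefix_rVS (i : 'I_n) h :
  prefix_rV i.+1 h = prefix_rV i h + h ord0 i *: delta_mx ord0 i.
Proof.
apply/rowP => j; rewrite !mxE eqxx/= ltnS leq_eqVlt.
case: (eqVneq j i) => [->|ji]; first by rewrite eqxx ltnn add0r mulr1.
by rewrite (inj_eq val_inj) (negbTE ji)/= mulr0 addr0.
Qed.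

(** Pigeonhole: if all [n] increments along the path were below [a / n], their telescoping sum would
    be below [a]. The sum of strict inequalities is strict because [n0] makes it nonempty. *)
Lemma telescoping_increment u x h (a : R) : (0 < n)%N -> a <= `|u (x + h) - u x| ->
  exists i : 'I_n, a / n%:R <=
    `|u (x + prefix_rV i h + h ord0 i *: delta_mx ord0 i) - u (x + prefix_rV i h)|.
Proof.
move=> n0 ah; apply: contrapT => /forallNP small.
have h0 : prefix_rV 0 h = 0 by apply/rowP => j; rewrite !mxE.
have hn : prefix_rV n h = h by apply/rowP => j; rewrite !mxE ltn_ord.
have : `|u (x + h) - u x| < a.
  rewrite -[in X in `|X|]hn -[x in X in _ - u X]addr0 -h0.
  rewrite -(telescope_sumr (fun k => u (x + prefix_rV k h)) (leq0n n)) big_mkord.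
  apply: le_lt_trans (ler_norm_sum _ _ _) _.
  have -> : a = \sum_(i < n) a / n%:R.
    by rewrite sumr_const card_ord -[RHS]mulr_natr divfK// pnatr_eq0 -lt0n.
  apply: ltr_sum => [|i _]; first by apply/hasP; exists (Ordinal n0); rewrite ?mem_index_enum.
  by rewrite prefix_rVS addrA ltNge; exact/negP/small.
by rewrite ltNge ah.
Qed.

Lemma measurable_prefix_rV k : measurable_fun setT (prefix_rV k).
Proof.
apply: measurable_fun_rV => i.
case ik : (i < k)%N; under eq_fun do rewrite mxE ik.
  exact: measurable_rV_coord.
exact: measurable_cst.
Qed.

End telescoping.

(** * Measure of near-diagonal sets of pairs *)

Section window.
Context {R : realType} {n : nat}.
Notation lam := (@lebesgue_rV R n).

Lemma measurable_rV_addfun d (T : measurableType d) (f g : T -> 'rV[R]_n) :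
  measurable_fun setT f -> measurable_fun setT g ->
  measurable_fun setT (fun x => f x + g x).
Proof.
move=> mf mg; apply: measurable_fun_rV => i; under eq_fun do rewrite mxE.
by apply: measurable_funD; apply: (measurableT_comp (measurable_rV_coord i)).
Qed.

Lemma measurable_rV_opp : measurable_fun setT (fun x : 'rV[R]_n => - x).
Proof.
apply: measurable_fun_rV => i; under eq_fun do rewrite mxE.
by apply: measurable_funN; exact: measurable_rV_coord.
Qed.

(** With z = (x, x + h), the set [A] is tested at [x + s h], later an intermediate point of the path
    from [x] to [x + h]. *)
Definition near_diag (r : R) (s : 'rV[R]_n -> 'rV[R]_n) (A : set 'rV[R]_n) :
    set ('rV[R]_n * 'rV[R]_n) :=
  [set z | `|z.2 - z.1| <= r /\ A (z.1 + s (z.2 - z.1))].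

Lemma measurable_near_diag r s A : 0 <= r -> measurable_fun setT s ->
  measurable A -> measurable (near_diag r s A).
Proof.
move=> r0 ms mA.
have md : measurable_fun setT (fun z : 'rV[R]_n * 'rV[R]_n => z.2 - z.1).
  apply: measurable_rV_addfun; first exact: measurable_snd.
  by apply: (measurableT_comp measurable_rV_opp); exact: measurable_fst.
have msd : measurable_fun setT (fun z : 'rV[R]_n * 'rV[R]_n => z.1 + s (z.2 - z.1)).
  apply: measurable_rV_addfun; first exact: measurable_fst.
  exact: (measurableT_comp ms md).
have mB := @measurable_closed_ball_rV R n 0 r r0.
rewrite (_ : near_diag _ _ _ =
  (fun z => z.2 - z.1) @^-1` [set y | `|y - 0| <= r] `&`
  (fun z => z.1 + s (z.2 - z.1)) @^-1` A); last first.
  by apply/seteqP; split => z; rewrite /near_diag/= subr0.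
apply: measurableI; rewrite -[X in measurable X]setTI; [exact: md|exact: msd].
Qed.

(** In the variables (x, h), the condition on [x] for fixed [h] defines a translate of [A], of the
    same measure, and [h] ranges over a cube of side [2 * r]. *)
Lemma lebesgue_near_diag r s A : 0 <= r -> measurable_fun setT s -> measurable A ->
  ((lam \x lam) (near_diag r s A) = ((2 * r) ^+ n)%:E * lam A)%E.
Proof.
move=> r0 ms mA; have mE := measurable_near_diag r0 ms mA.
have mB := @measurable_closed_ball_rV R n 0 r r0.
pose B : set 'rV[R]_n := [set y | `|y - 0| <= r].
pose G (z : 'rV[R]_n * 'rV[R]_n) : \bar R := (\1_B z.2 * \1_A (z.1 + s z.2))%:E.
have mi (X : set 'rV[R]_n) : measurable X -> measurable_fun setT (\1_X : 'rV[R]_n -> R).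
  by move=> mX; exact: measurable_indic.
have G0 z : (0 <= G z)%E by rewrite lee_fin mulr_ge0.
have mG : measurable_fun setT G.
  apply/measurable_EFinP; apply: measurable_funM.
    by apply: (measurableT_comp (mi B mB)); exact: measurable_snd.
  apply: (measurableT_comp (mi A mA)).
  apply: measurable_rV_addfun; first exact: measurable_fst.
  by apply: (measurableT_comp ms); exact: measurable_snd.
have mindE : measurable_fun setT (fun z => (\1_(near_diag r s A) z : R)%:E).
  by apply/measurable_EFinP; exact: measurable_indic.
rewrite -[in LHS](setIT (near_diag r s A)) -integral_indic//.
rewrite (fubini_tonelli1 (m1 := lam) (m2 := lam) _ mindE); last first.
  by move=> z; rewrite lee_fin.
rewrite /fubini_F.
(* For fixed [x], the second variable is replaced by its displacement [h] from [x]. *)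
transitivity (\int[lam]_x \int[lam]_h G (x, h))%E.
  apply: eq_integral => x _; rewrite -[LHS](ge0_integral_rV_translate x); last first.
  - by move=> y; rewrite lee_fin.
  - by apply: (measurableT_comp mindE); exact: measurable_pair1.
  apply: eq_integral => h _; rewrite /G/= !indicE -natrM mulnb; congr (_%:R%:E).
  congr nat_of_bool; apply/idP/idP.
    rewrite inE /near_diag/= addrK => -[hr As].
    by apply/andP; split; apply/mem_set => //; rewrite /B/= subr0.
  move=> /andP[/set_mem + /set_mem As]; rewrite /B/= subr0 => hr.
  by apply/mem_set; rewrite /near_diag/= addrK.
rewrite (fubini_tonelli (m1 := lam) (m2 := lam) _ mG G0).
transitivity (\int[lam]_h ((\1_B h)%:E * lam A))%E.
  apply: eq_integral => h _; rewrite /G/=.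
  under eq_integral do rewrite EFinM.
  have mAs : measurable_fun setT (fun x : 'rV[R]_n => (\1_A (x + s h) : R)%:E).
    apply/measurable_EFinP; apply: (measurableT_comp (mi A mA)).
    exact: measurable_rV_add.
  rewrite ge0_integralZl//.
  congr (_ * _)%E; rewrite (ge0_integral_rV_translate (s h) (f := fun x => (\1_A x)%:E)).
  - by rewrite integral_indic// setIT.
  - by apply/measurable_EFinP; exact: measurable_indic.
  - by move=> x; rewrite lee_fin.
rewrite ge0_integralZr//; last by apply/measurable_EFinP; exact: measurable_indic.
rewrite integral_indic// setIT; congr (_ * _)%E; exact: lebesgue_rV_closed_ball.
Qed.

End window.

Lemma measure_bigcup_ord_le d (T : measurableType d) (R : realType)
    (mu : {measure set T -> \bar R}) n (F : 'I_n -> set T) :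
  (forall i, measurable (F i)) ->
  (mu (\bigcup_i F i) <= \sum_(i < n) mu (F i))%E.
Proof.
move=> mF; pose A k := oapp F set0 (insub k).
have FA (i : 'I_n) : A i = F i by rewrite /A valK.
have mA k : measurable (A k).
  by rewrite /A; case: insub => [j|] /=; [exact: mF|exact: measurable0].
have -> : \bigcup_i F i = \big[setU/set0]_(k < n) A k.
  rewrite -bigcup_mkord; apply/seteqP; split=> [x [i _ Fix]|x [k /= kn]].
    by exists i => /=; rewrite ?FA.
  by rewrite /A insubT; exists (Ordinal kn).
apply: le_trans (Boole_inequality mu _) _ => [k _|]; first exact: mA.
by under eq_bigr do rewrite FA.
Qed.

(** The least [k] satisfying the first inequality works: minimality gives the second one, and for
    [k = 0] it is the hypothesis [a <= r]. *)
Lemma dyadic_scale (R : realType) (r a : R) : 0 < a <= r ->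
  exists k, r / 2 ^+ k.+1 < a <= r / 2 ^+ k.
Proof.
move=> /andP[a0 ar].
have [k0 k0P] : exists k, r / 2 ^+ k.+1 < a.
  (* With m = trunc(r / a) + 1, r / a < m < 2^m. *)
  exists (Num.trunc (r / a)); rewrite ltr_pdivrMr ?exprn_gt0// mulrC -ltr_pdivrMr//.
  apply: lt_trans (truncnS_gt _) _.
  by rewrite -natrX ltr_nat ltn_expl.
case: (ex_minnP (ex_intro (fun k => r / 2 ^+ k.+1 < a) k0 k0P)) => k kP kmin.
exists k; rewrite kP/=; case: k kP kmin => [|k] _ kmin; first by rewrite expr0 divr1.
by rewrite leNgt; apply/negP => /kmin; rewrite ltnn.
Qed.

(** * The Euclidean norm dominates the sup norm *)

Section euclidean.
Context {R : realType} {n : nat}.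

Lemma coord_le_euclidean_norm (x : 'rV[R]_n) i : `|x ord0 i| <= euclidean_norm x.
Proof.
rewrite -sqrtr_sqr; apply: ler_wsqrtr.
rewrite (bigD1 i)//= lerDl; apply: sumr_ge0 => j _; exact: sqr_ge0.
Qed.

Lemma norm_le_euclidean_norm (x : 'rV[R]_n) : `|x| <= euclidean_norm x.
Proof. by apply/rV_norm_le; [exact: sqrtr_ge0|exact: coord_le_euclidean_norm]. Qed.

Lemma measurable_euclidean_norm : measurable_fun setT (@euclidean_norm R n).
Proof.
apply: measurableT_comp; first by apply: continuous_measurable_fun; exact: sqrt_continuous.
by apply: measurable_sum => i; apply: measurable_funX; exact: measurable_rV_coord.
Qed.

End euclidean.

(** * The dyadic sum over points heavy in one direction *)

Section line_heavy.
Context {R : realType} {n : nat}.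
Notation mu := (@lebesgue_measure R).
Notation lam := (@lebesgue_rV R n).
Variables (g : 'rV[R]_n -> R) (i : 'I_n) (c : R).
Hypotheses (cg : continuous g) (c0 : 0 < c) (n0 : (0 < n)%N).

Definition line_heavy (r : R) : set 'rV[R]_n := [set x |
  ((c * r ^+ n.+1)%:E <=
   \int[mu]_(t in `[(- r)%R, r]) `|g (x + t *: delta_mx ord0 i)|%:E)%E].

Lemma measurable_line : measurable_fun setT
  (fun z : 'rV[R]_n * R => `|g (z.1 + z.2 *: delta_mx ord0 i)|%:E).
Proof.
apply/measurable_EFinP; apply: measurableT_comp => //.
apply: (measurableT_comp (continuous_measurable_rV cg)).
apply: measurable_fun_rV => j; under eq_fun do rewrite !mxE.
apply: measurable_funD.
  by apply: (measurableT_comp (measurable_rV_coord j)); exact: measurable_fst.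
by apply: measurable_funM => //; exact: measurable_snd.
Qed.

Lemma measurable_line_heavy r : measurable (line_heavy r).
Proof. exact: (measurable_ge_integral _ measurable_line). Qed.

(** On the line through [x] parallel to the [i]-th axis, [line_heavy] becomes the [heavy_window] of
    [F], so [heavy_window_integral] applies to each line. *)
Lemma sum_line_heavy_le m r : 0 < r ->
  (\sum_(k < m) ((r / 2 ^+ k) ^+ n)%:E * lam (line_heavy (r / 2 ^+ k)) <=
   (18 / c)%:E * \int[lam]_x `|g x|%:E)%E.
Proof.
move=> r0; have r20 k : 0 <= r / 2 ^+ k by rewrite divr_ge0// ?exprn_ge0// ltW.
have c180 : 0 <= 18 / c by rewrite divr_ge0// ltW.
have mg : measurable_fun setT (fun x : 'rV[R]_n => `|g x|%:E).
  apply/measurable_EFinP; apply: measurableT_comp => //.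
  exact: continuous_measurable_rV.
have w0 (k : 'I_m) : 0 <= (r / 2 ^+ k) ^+ n by rewrite exprn_ge0.
have mA k : measurable (line_heavy (r / 2 ^+ k)) by exact: measurable_line_heavy.
rewrite -(integral_sum_indic lam w0)//.
rewrite -ge0_integralZl_EFin//.
apply: (integral_rV_line_le (i := i)).
- by apply/measurable_EFinP; apply: measurable_sum => k; apply: measurable_funM.
- by move=> x; rewrite lee_fin; apply: sumr_ge0 => k _; rewrite mulr_ge0.
- exact: measurable_funeM.
- by move=> x; rewrite mule_ge0// lee_fin.
move=> x; pose F t := `|g (x + t *: delta_mx ord0 i)|%:E.
have mF : measurable_fun setT F.
  have mpair : measurable_fun setT (fun t : R => (x, t)) by exact: measurable_pair1.
  exact: (measurableT_comp measurable_line mpair).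
have F0 t : (0 <= F t)%E by rewrite lee_fin.
have -> : (\int[mu]_t ((18 / c)%:E * `|g (x + t *: delta_mx ord0 i)|%:E) =
    (18 / c)%:E * \int[mu]_t F t)%E.
  by apply: ge0_integralZl_EFin.
have := heavy_window_integral mF F0 c0 n0 m r0.
(* The left sides agree: moving by [s] and then by [t] along the line is moving by [s + t]. *)
apply: le_trans; rewrite le_eqVlt; apply/orP; left; apply/eqP.
apply: eq_integral => s _.
congr EFin; apply: eq_bigr => k _; congr (_ * _); rewrite !indicE; congr (_%:R).
congr nat_of_bool; rewrite /line_heavy /heavy_window /F !mem_setE.
congr (_ <= _)%E; apply: eq_integral => t _.
by rewrite scalerDl addrA.
Qed.

End line_heavy.

(** * The weak type estimate *)

Section weak_type.
Context {R : realType} {n : nat}.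
Notation mu := (@lebesgue_measure R).
Notation lam := (@lebesgue_rV R n).
Variables (u : 'rV[R]_n -> R) (B l : R).
Hypotheses (n0 : (0 < n)%N) (su : smooth u) (uB : forall x, `|u x| <= B) (l0 : 0 < l).

Lemma smooth_continuous : continuous u.
Proof. by have [] := su [::]. Qed.

Lemma smooth_derivable i x : derivable u x (delta_mx ord0 i).
Proof. by have [_] := su [::]; exact. Qed.

Lemma smooth_partial_continuous i : continuous (partial i u).
Proof. by have [] := su [:: i]. Qed.

(** The factor [n] is lost by selecting one coordinate, and 2^(n+1) by replacing |h| with a dyadic
    scale [r k] that may be almost twice as large. *)
Let c : R := l / (n%:R * 2 ^+ n.+1).
(* Every [z] in the level set satisfies [`|z.2 - z.1| <= r0]. *)
Let r0 : R := 1 + 2 * B / l.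
Let r (k : nat) : R := r0 / 2 ^+ k.
Let A k i := line_heavy (partial i u) i c (r k).
Let W k (i : 'I_n) := near_diag (r k) (prefix_rV i) (A k i).

Let B0 : 0 <= B. Proof. exact: le_trans (normr_ge0 _) (uB 0). Qed.
Let c_gt0 : 0 < c.
Proof. by rewrite divr_gt0// mulr_gt0// ?ltr0n// exprn_gt0. Qed.
Let r0_gt0 : 0 < r0.
Proof. by rewrite ltr_wpDr// divr_ge0// ?mulr_ge0// ltW. Qed.
Let r_ge0 k : 0 <= r k.
Proof. by rewrite divr_ge0 ?exprn_ge0// ltW. Qed.

Let mA k i : measurable (A k i).
Proof. by apply: measurable_line_heavy; exact: smooth_partial_continuous. Qed.

Let mW k i : measurable (W k i).
Proof. by apply: measurable_near_diag => //; exact: measurable_prefix_rV. Qed.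

Lemma level_set_cover (z : 'rV[R]_n * 'rV[R]_n) : 0 < `|z.2 - z.1| ->
  l * `|z.2 - z.1| ^+ n.+1 <= `|u z.2 - u z.1| -> exists k i, W k i z.
Proof.
set h := z.2 - z.1 => h0 lh.
have z2 : z.2 = z.1 + h by rewrite /h addrC subrK.
(* Otherwise |h| >= 1, hence l |h| <= l |h|^(n+1) <= 2 B, while l r0 = l + 2 B. The summand 1 in
   [r0] serves both bounds. *)
have hr : `|h| <= r0.
  rewrite leNgt; apply/negP => rh.
  have h1 : 1 <= `|h| by apply: le_trans (ltW rh); rewrite /r0 lerDl divr_ge0 ?mulr_ge0// ltW.
  have : l * `|h| <= 2 * B.
    apply: le_trans (le_trans _ lh) _.
      by rewrite ler_pM2l// exprS ler_peMr// exprn_ege1.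
    by apply: le_trans (ler_normB _ _) _; rewrite mulr2n mulrDl !mul1r lerD.
  rewrite leNgt; apply/negP; rewrite negbK.
  apply: lt_le_trans (_ : l * r0 <= _); last by rewrite ler_pM2l// ltW.
  by rewrite /r0 mulrDr mulr1 mulrCA divff ?gt_eqF// mulr1 ltrDr.
have /dyadic_scale[k /andP[rk hk]] : 0 < `|h| <= r0 by rewrite h0.
exists k.
have [i hi] : exists i : 'I_n, `|u z.2 - u z.1| / n%:R <=
    `|u (z.1 + prefix_rV i h + h ord0 i *: delta_mx ord0 i) - u (z.1 + prefix_rV i h)|.
  by apply: telescoping_increment => //; rewrite -z2.
exists i; split; first exact: hk.
rewrite /A /line_heavy/=.
apply: le_trans (window_increment_le _ (le_trans (rV_coord_le h i) hk) _ _); last 2 first.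
- by move=> y; exact: smooth_derivable.
- exact: smooth_partial_continuous.
rewrite lee_fin; apply: le_trans hi.
apply: (@le_trans _ _ (l * `|h| ^+ n.+1 / n%:R)); last first.
  by rewrite ler_pM2r// invr_gt0 ltr0n.
(* The choice of [c] reduces the claim to [r k.+1 <= |h|]. *)
have -> : c * r k ^+ n.+1 = l * r k.+1 ^+ n.+1 / n%:R.
  rewrite (_ : r k.+1 = r k / 2); last by rewrite /r exprSr invfM mulrA.
  have : 2 ^+ n.+1 != 0 :> R by rewrite expf_neq0.
  rewrite /c (expr_div_n (r k)); move: (r k ^+ n.+1) (2 ^+ n.+1) => P Q Q0; field.
  by rewrite Q0 pnatr_eq0 -lt0n n0.
rewrite ler_pM2r ?invr_gt0 ?ltr0n// ler_pM2l// lerXn2r ?nnegrE//.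
exact: ltW.
Qed.

(** A sum over [n] coordinates, 2^n from cubes of side [2 * r k], and 18 / c from
    [sum_line_heavy_le], with l / c = n 2^(n+1). *)
Definition weak_const : R := n%:R * 2 ^+ n * 18 * n%:R * 2 ^+ n.+1.

Lemma partial_le_gradient i x : `|partial i u x| <= euclidean_norm (gradient u x).
Proof. by apply: le_trans (coord_le_euclidean_norm _ i); rewrite mxE. Qed.

Lemma measurable_gradient_norm : measurable_fun setT (euclidean_norm \o gradient u).
Proof.
apply: measurableT_comp; first exact: measurable_euclidean_norm.
apply: measurable_fun_rV => i; under eq_fun do rewrite mxE.
by apply: continuous_measurable_rV; exact: smooth_partial_continuous.
Qed.

(** [E] is any measurable part of the level set, so that for general [p] the estimate applies to
    level sets of the quotient with a rescaled [l]. *)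
Lemma weak_type_estimate (E : set ('rV[R]_n * 'rV[R]_n)) : measurable E ->
  (forall z, E z -> 0 < `|z.2 - z.1| /\ l * `|z.2 - z.1| ^+ n.+1 <= `|u z.2 - u z.1|) ->
  ((lam \x lam) E <= (weak_const / l)%:E *
    'N[lam]_1 [EFin \o (euclidean_norm \o gradient u)])%E.
Proof.
move=> mE Esub.
pose V k := \bigcup_i W k i.
have mV k : measurable (V k) by apply: fin_bigcup_measurable => // i _; exact: mW.
have EV : E `<=` \bigcup_k V k.
  by move=> z /Esub[z0 zl]; have [k [i Wz]] := level_set_cover z0 zl; exists k => //; exists i.
apply: le_trans (measure_sigma_subadditive (lam \x lam)%E mV mE EV) _.
rewrite Lnorm1; set G := (\int[lam]_x _)%E.
have G0 : (0 <= G)%E by exact: integral_ge0.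
have partG i : (\int[lam]_x `|partial i u x|%:E <= G)%E.
  apply: ge0_le_integral => //.
  - apply/measurable_EFinP; apply: measurableT_comp => //.
    by apply: continuous_measurable_rV; exact: smooth_partial_continuous.
  - apply: measurableT_comp => //; apply/measurable_EFinP.
    exact: measurable_gradient_norm.
  - move=> x _; rewrite lee_fin ger0_norm; last exact: sqrtr_ge0.
    exact: partial_le_gradient.
(* The series over scales is bounded through its partial sums, by a constant independent of [m]. *)
apply: lime_le; first by apply: is_cvg_nneseries => k _ _.
apply: nearW => m; rewrite big_mkord.
apply: (@le_trans _ _ (\sum_(k < m) \sum_(i < n) ((2 * r k) ^+ n)%:E * lam (A k i))%E).
  apply: lee_sum => k _; apply: le_trans (measure_bigcup_ord_le (lam \x lam)%E (mW k)) _.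
  apply: lee_sum => i _.
  rewrite le_eqVlt; apply/orP; left; apply/eqP.
  exact: (lebesgue_near_diag (r_ge0 k) (measurable_prefix_rV i) (mA k i)).
rewrite exchange_big/=.
apply: (@le_trans _ _ (\sum_(i < n) (2 ^+ n * (18 / c))%:E * G)%E).
  apply: lee_sum => i _.
  rewrite (eq_bigr (fun k : 'I_m => (2 ^+ n)%:E * ((r k ^+ n)%:E * lam (A k i)))%E); last first.
    by move=> k _; rewrite muleA -EFinM exprMn.
  rewrite -ge0_sume_distrr; last first.
    by move=> k _; rewrite mule_ge0// lee_fin exprn_ge0.
  rewrite EFinM -muleA; apply: lee_wpmul2l; first by rewrite lee_fin exprn_ge0.
  apply: le_trans (sum_line_heavy_le i (@smooth_partial_continuous i) c_gt0 n0 m r0_gt0) _.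
  apply: lee_wpmul2l; last exact: partG.
  by rewrite lee_fin divr_ge0// ltW.
rewrite -ge0_sume_distrl; last first.
  by move=> i _; rewrite lee_fin mulr_ge0// ?exprn_ge0// divr_ge0// ltW.
rewrite sumEFin sumr_const card_ord -[X in X%:E]mulr_natl.
apply: lee_wpmul2r => //; rewrite lee_fin le_eqVlt; apply/orP; left; apply/eqP.
rewrite /c /weak_const; have : 2 ^+ n.+1 != 0 :> R by rewrite expf_neq0.
move: (2 ^+ n) (2 ^+ n.+1) => P Q Q0; field.
by rewrite Q0 gt_eqF//= pnatr_eq0 -lt0n n0.
Qed.

End weak_type.

(** * The sup norm of [u] and the reduction of general p to p = 1 *)

Section sup_norm.
Context {R : realType} {n : nat}.
Implicit Types u : 'rV[R]_n -> R.

Lemma compactly_supported_bounded u : continuous u -> compactly_supported u ->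
  exists B, forall x, `|u x| <= B.
Proof.
move=> cu ku.
have : compact (u @` closure [set x | u x != 0]).
  by apply: continuous_compact => //; exact: continuous_subspaceT.
move=> /compact_bounded[M [_ Mu]]; exists (`|M| + 1) => x.
have MM : M < `|M| + 1 by rewrite (le_lt_trans (ler_norm M))// ltrDl.
have [->|ux] := eqVneq (u x) 0; first by rewrite normr0 addr_ge0.
by apply: (Mu _ MM); exists x => //; exact: subset_closure.
Qed.

(** Compact support makes the norm finite, and continuity turns the essential bound into a pointwise
    one. *)
Lemma Lnormy_bounded u : continuous u -> compactly_supported u ->
  exists2 m, 'N[lebesgue_rV n]_+oo [EFin \o u]%E = m%:E & forall x, `|u x| <= m.
Proof.
move=> cu ku; have [B uB] := compactly_supported_bounded cu ku.
have B0 : 0 <= B by exact: le_trans (normr_ge0 _) (uB 0).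
have NB : ('N[lebesgue_rV n]_+oo [EFin \o u] <= B%:E)%E.
  rewrite unlock; case: ifPn => _; last by rewrite lee_fin.
  by apply/ess_supP; apply: nearW => x /=; rewrite lee_fin.
have Nu x := le_Lnormy x cu.
case: ('N[_]_+oo [_])%E NB Nu => [m| |]// _ Nu; last by have := Nu 0.
by exists m.
Qed.

Lemma measurable_difference_quotient a u : continuous u ->
  measurable_fun setT (difference_quotient a u).
Proof.
move=> cu; have mu := continuous_measurable_rV cu.
have me : measurable_fun setT
    (fun z : 'rV[R]_n * 'rV[R]_n => euclidean_norm (z.1 - z.2)).
  apply: (measurableT_comp measurable_euclidean_norm).
  apply: measurable_rV_addfun; first exact: measurable_fst.
  by apply: (measurableT_comp measurable_rV_opp); exact: measurable_snd.
rewrite (_ : difference_quotient a u = (fun z => (u z.1 - u z.2) *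
    euclidean_norm (z.1 - z.2) `^ (- a))); last first.
  by apply/funext => z; rewrite powRN.
apply: measurable_funM; last exact: (measurableT_comp (measurable_powR (- a)) me).
apply: measurable_funB; apply: (measurableT_comp mu).
  exact: measurable_fst.
exact: measurable_snd.
Qed.

(** Raising l e^((n+1)/p) <= D to the power p gives l^p e^(n+1) <= D^p <= D (2 m)^(p-1), and the sup
    norm is at most the Euclidean norm [e]. Positivity of [l] excludes the diagonal and [m = 0]. *)
Lemma difference_quotient_level (p m l : R) u z : 1 <= p ->
  (forall x, `|u x| <= m) -> 0 < l ->
  l <= `|difference_quotient ((n%:R + 1) / p) u z| ->
  [/\ 0 < m, 0 < `|z.2 - z.1| &
    l `^ p / (2 * m) `^ (p - 1) * `|z.2 - z.1| ^+ n.+1 <= `|u z.2 - u z.1|].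
Proof.
move=> p1 um l0; rewrite /difference_quotient => lz.
have p0 : 0 < p by exact: lt_le_trans p1.
have d0 : u z.1 - u z.2 != 0.
  by apply: contraTneq lz => ->; rewrite mul0r normr0 -ltNge.
have m0 : 0 < m.
  rewrite lt_neqAle (le_trans (normr_ge0 _) (um 0)) andbT.
  apply: contra_neq d0 => m0.
  have u0 x : u x = 0 by apply/eqP; rewrite -normr_le0 m0.
  by rewrite !u0 subrr.
have z0 : 0 < `|z.2 - z.1|.
  by rewrite normr_gt0 subr_eq0; apply: contra_neq d0 => ->; rewrite subrr.
set e := euclidean_norm (z.1 - z.2) in lz.
have ze : `|z.2 - z.1| <= e by rewrite distrC; exact: norm_le_euclidean_norm.
have e0 : 0 < e by exact: lt_le_trans ze.
split => //.
set D := `|u z.2 - u z.1|.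
have D2m : D <= 2 * m.
  by apply: le_trans (ler_normB _ _) _; rewrite mulr2n mulrDl !mul1r lerD.
have D0 : 0 < D by rewrite /D distrC normr_gt0.
have leD : l * e `^ ((n%:R + 1) / p) <= D.
  move: lz; rewrite normrM normfV (ger0_norm (powR_ge0 _ _)) distrC -/D.
  by rewrite ler_pdivlMr// powR_gt0.
have lpD : l `^ p * e ^+ n.+1 <= D * (2 * m) `^ (p - 1).
  have -> : l `^ p * e ^+ n.+1 = (l * e `^ ((n%:R + 1) / p)) `^ p.
    rewrite powRM ?powR_ge0 ?ltW//; congr (_ * _).
    by rewrite -powRrM divfK ?gt_eqF// natr1 powR_mulrn// ltW.
  apply: (@le_trans _ _ (D `^ p)).
    by apply: ge0_ler_powR; rewrite ?nnegrE ?mulr_ge0 ?powR_ge0// ltW.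
  have -> : D `^ p = D * D `^ (p - 1).
    by rewrite -{2}(powRr1 (ltW D0)) -powRD ?(gt_eqF D0) ?implybT// addrC subrK.
  rewrite ler_pM2l//.
  by apply: ge0_ler_powR; rewrite ?nnegrE ?subr_ge0 ?mulr_ge0// ltW.
have q0 : 0 < (2 * m) `^ (p - 1) by apply: powR_gt0; rewrite mulr_gt0.
rewrite mulrAC ler_pdivrMr//; apply: le_trans lpD.
by rewrite ler_pM2l ?powR_gt0// lerXn2r// ?nnegrE// ltW.
Qed.

End sup_norm.

(** * The Marcinkiewicz estimate, with a constant uniform in p *)

Theorem theorem4 (R : realType) (N : nat) (hN : (1 <= N)%N) :
  exists C : R, forall p : R, 1 <= p ->
  forall u : 'rV[R]_N -> R, smooth u -> compactly_supported u ->
  (marcinkiewicz_norm (lebesgue_rV N \x lebesgue_rV N) p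
     (difference_quotient ((N%:R + 1) / p) u)
   <= C%:E * 'N[lebesgue_rV N]_+oo [EFin \o u] `^ (1 - p^-1)%R
           * 'N[lebesgue_rV N]_1 [EFin \o (euclidean_norm \o gradient u)]
               `^ p^-1)%E.
Proof.
pose K : R := @weak_const R N.
have K1 : 1 <= K.
  rewrite /K /weak_const; have N1 : 1 <= N%:R :> R by rewrite ler1n.
  by rewrite !mulr_ege1// ?exprn_ege1// ler1n.
(* The proof yields 2^(1 - 1/p) K^(1/p), which is at most 2 K for every p >= 1 because K >= 1. *)
exists (2 * K) => p p1 u su ku.
have p0 : 0 < p by exact: lt_le_trans p1.
have cu := smooth_continuous su.
have [m mE um] := Lnormy_bounded cu ku; rewrite mE.
set G := 'N[_]_1 [_]%E; have G0 : (0 <= G)%E by exact: Lnorm_ge0.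
have m0 : 0 <= m by exact: le_trans (normr_ge0 _) (um 0).
pose Q : R := K * (2 * m) `^ (p - 1).
have Q0 : 0 <= Q by rewrite mulr_ge0 ?powR_ge0// (le_trans _ K1).
have level_bound l : 0 < l ->
    ((l `^ p)%:E * (lebesgue_rV N \x lebesgue_rV N)
      [set z | (l <= `|difference_quotient ((N%:R + 1) / p) u z|)%R] <= Q%:E * G)%E.
  move=> l0; set E := [set z | _].
  have mE' : measurable E.
    rewrite (_ : E =
      (fun z => `|difference_quotient ((N%:R + 1) / p) u z|) @^-1` `[l, +oo[%classic).
      rewrite -[X in measurable X]setTI.
      apply: measurableT_comp => //; exact: measurable_difference_quotient.
    by apply/seteqP; split => z; rewrite /E/= in_itv/= andbT.
  (* If [m] is 0 the level set is empty; otherwise the rescaled level l^p / (2 m)^(p-1) is positive,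
     as the weak type estimate requires. *)
  have [m00|mpos] := leP m 0.
    rewrite (_ : E = set0) ?measure0 ?mule0 ?mule_ge0 ?lee_fin//.
    apply/seteqP; split=> // z /(difference_quotient_level p1 um l0)[+ _ _].
    by rewrite ltNge m00.
  have q0 : 0 < (2 * m) `^ (p - 1) by apply: powR_gt0; rewrite mulr_gt0.
  have l'0 : 0 < l `^ p / (2 * m) `^ (p - 1) by rewrite divr_gt0// powR_gt0.
  have lp0 : 0 < l `^ p by rewrite powR_gt0.
  apply: le_trans (lee_wpmul2l _ (weak_type_estimate hN su um l'0 mE' _)) _.
  - by rewrite lee_fin ltW.
  - by move=> z /(difference_quotient_level p1 um l0)[].
  rewrite muleA -EFinM -/G -/K; apply: lee_wpmul2r => //.
  rewrite lee_fin le_eqVlt /Q; apply/orP; left; apply/eqP; field.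
  by rewrite !gt_eqF.
rewrite /marcinkiewicz_norm; set S := ereal_sup _.
have SQ : (S <= Q%:E * G)%E by apply: ge_ereal_sup => _ [l /= l0 <-]; exact: level_bound.
(* Taking p-th roots is monotone on nonnegative values; any single level, here 1, shows that the
   supremum is one. *)
have S0 : (0 <= S)%E.
  apply: (@le_trans _ _ ((1 `^ p)%:E * (lebesgue_rV N \x lebesgue_rV N)
      [set z | (1 <= `|difference_quotient ((N%:R + 1) / p) u z|)%R])%E).
    by rewrite mule_ge0// lee_fin powR_ge0.
  by apply: ereal_sup_ubound; exists 1 => //=; exact: ltr01.
have ip0 : 0 <= p^-1 by rewrite invr_ge0 ltW.
have ip1 : p^-1 <= 1 by rewrite invf_le1.
apply: (@le_trans _ _ ((Q%:E * G) `^ p^-1)%E).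
  by apply: gt0_ler_poweR => //; rewrite in_itv/= ?leey ?andbT// mule_ge0.
rewrite poweRM// poweR_EFin poweR_EFin -EFinM.
apply: lee_wpmul2r; first exact: poweR_ge0.
rewrite lee_fin /Q powRM ?powR_ge0//; last exact: le_trans K1.
rewrite -powRrM (_ : (p - 1) / p = 1 - p^-1); last first.
  by rewrite mulrBl divff ?gt_eqF// mul1r.
rewrite powRM// mulrA; apply: ler_wpM2r; first exact: powR_ge0.
rewrite mulrC; apply: ler_pM; rewrite ?powR_ge0//.
  by rewrite -[leRHS]powRr1//; apply: ler_powR; rewrite ?ler1n// gerBl.
rewrite -[leRHS]powRr1 ?(le_trans _ K1)//.
exact: ler_powR.
Qed.
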